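(* Every $\lambda$-anti-homomorphic weak left brace $(S,+,\cdot)$ is a dual weak left brace.
   Context: A semigroup $(S,+)$ (not necessarily commutative) is an inverse semigroup if for each $a\in S$ there is a unique element $-a$ with $a-a+a=a$ and $-a+a-a=-a$; for an inverse semigroup $(S,\cdot)$ written multiplicatively this element is written $a^{-1}$. An inverse semigroup $(S,\cdot)$ is a Clifford semigroup if $a^{-1}a=aa^{-1}$ for all $a$. A weak left brace is a triple $(S,+,\cdot)$ with $(S,+)$ and $(S,\cdot)$ inverse semigroups such that $x(y+z)=xy-x+xz$ and $xx^{-1}=-x+x$ for all $x,y,z\in S$. It is a dual weak left brace if moreover $(S,\cdot)$ is a Clifford semigroup. In a weak left brace let $\lambda_x(y)=-x+xy$. A weak left brace is $\lambda$-anti-homomorphic if $\lambda_y(\lambda_x(z))=\lambda_{x+y}(z)$ for all $x,y,z\in S$, i.e. $-y+y(-x+xz)=-y-x+(x+y)z$. *)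

(* Defs.v *)
From mathcomp Require Import all_boot.

Set Implicit Arguments.
Unset Strict Implicit.
Unset Printing Implicit Defensive.

Declare Scope wlb_scope.
Delimit Scope wlb_scope with wlb.

(* The inverse is carried as a function; [unique] makes it the one determined
   by [op].  The carriers need not be finite, nor have decidable equality. *)
Record inverse_semigroup (S : Type) (op : S -> S -> S) (inv : S -> S) : Prop :=
  InverseSemigroup {
    inverse_semigroup_assoc : associative op;
    inverse_semigroup_inv : forall a : S,
      unique (fun b : S => op (op a b) a = a /\ op (op b a) b = b) (inv a)
  }.

Record clifford_semigroup (S : Type) (op : S -> S -> S) (inv : S -> S) : Prop :=
  CliffordSemigroup {
    clifford_semigroup_inverse : inverse_semigroup op inv;
    clifford_semigroup_comm : forall a : S, op (inv a) a = op a (inv a)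
  }.

Record weakLeftBrace : Type := WeakLeftBrace {
  wlb_sort :> Type;
  wlb_add : wlb_sort -> wlb_sort -> wlb_sort;
  wlb_opp : wlb_sort -> wlb_sort;
  wlb_mul : wlb_sort -> wlb_sort -> wlb_sort;
  wlb_inv : wlb_sort -> wlb_sort;
  wlb_add_inverse_semigroup : inverse_semigroup wlb_add wlb_opp;
  wlb_mul_inverse_semigroup : inverse_semigroup wlb_mul wlb_inv;
  wlb_mul_add : forall x y z : wlb_sort,
    wlb_mul x (wlb_add y z) =
    wlb_add (wlb_add (wlb_mul x y) (wlb_opp x)) (wlb_mul x z);
  wlb_mul_inv : forall x : wlb_sort,
    wlb_mul x (wlb_inv x) = wlb_add (wlb_opp x) x
}.

Notation "x + y" := (wlb_add x y) : wlb_scope.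
Notation "- x" := (wlb_opp x) : wlb_scope.
Notation "x * y" := (wlb_mul x y) : wlb_scope.

Definition dual_weak_left_brace (B : weakLeftBrace) : Prop :=
  clifford_semigroup (@wlb_mul B) (@wlb_inv B).

Definition wlb_lambda (B : weakLeftBrace) (x y : B) : B := (- x + x * y)%wlb.

Definition lambda_anti_homomorphic (B : weakLeftBrace) : Prop :=
  forall x y z : B,
    wlb_lambda y (wlb_lambda x z) = wlb_lambda (x + y)%wlb z.

(* Main.v *)
Require Import Defs.
From mathcomp Require Import ssreflect ssrfun ssrbool.

Set Implicit Arguments.
Unset Strict Implicit.
Unset Printing Implicit Defensive.

(* In a weak left brace the idempotents [e] of the two operations coincide, the
   additive semigroup is Clifford, and [e * y = e + y], so that [lambda_e] is
   translation by [e].  Put [e = x * x^-1 = - x + x] and [f = x^-1 * x].  As the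
   addition is Clifford, [e + x = x], whence anti-homomorphy gives
   [lambda_x (e + z) = lambda_x (lambda_e z) = lambda_x z].  Since
   [lambda_x w = x * (x^-1 + w)], multiplying by [x^-1] yields
   [x^-1 + e + z = x^-1 + z]; adding [- x^-1] on the left for [z = f] gives
   [f + e = f].  The same for [x^-1] gives [e + f = e], so [e = f]. *)

(** * Inverse semigroups: idempotents commute, and inversion reverses products *)

Lemma inverse_semigroup_mulVK (S : Type) (op : S -> S -> S) (inv : S -> S)
    (hS : inverse_semigroup op inv) (a : S) :
  op (op a (inv a)) a = a.
Proof. by case: (inverse_semigroup_inv hS a) => -[]. Qed.

Lemma inverse_semigroup_invMK (S : Type) (op : S -> S -> S) (inv : S -> S)
    (hS : inverse_semigroup op inv) (a : S) :
  op (op (inv a) a) (inv a) = inv a.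
Proof. by case: (inverse_semigroup_inv hS a) => -[]. Qed.

Lemma inverse_semigroup_inv_eq (S : Type) (op : S -> S -> S) (inv : S -> S)
    (hS : inverse_semigroup op inv) (a b : S) :
  op (op a b) a = a -> op (op b a) b = b -> inv a = b.
Proof. by move=> ab ba; case: (inverse_semigroup_inv hS a) => _; apply. Qed.

Lemma inverse_semigroup_invK (S : Type) (op : S -> S -> S) (inv : S -> S)
    (hS : inverse_semigroup op inv) : involutive inv.
Proof.
move=> a; apply: (inverse_semigroup_inv_eq hS).
  exact: inverse_semigroup_invMK hS a.
exact: inverse_semigroup_mulVK hS a.
Qed.

Lemma inverse_semigroup_inv_idem (S : Type) (op : S -> S -> S) (inv : S -> S)
    (hS : inverse_semigroup op inv) (e : S) : op e e = e -> inv e = e.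
Proof. by move=> ee; apply: (inverse_semigroup_inv_eq hS); rewrite !ee. Qed.

Lemma inverse_semigroup_mulV_idem (S : Type) (op : S -> S -> S) (inv : S -> S)
    (hS : inverse_semigroup op inv) (a : S) :
  op (op a (inv a)) (op a (inv a)) = op a (inv a).
Proof.
by rewrite (inverse_semigroup_assoc hS) (inverse_semigroup_mulVK hS).
Qed.

Lemma inverse_semigroup_Vmul_idem (S : Type) (op : S -> S -> S) (inv : S -> S)
    (hS : inverse_semigroup op inv) (a : S) :
  op (op (inv a) a) (op (inv a) a) = op (inv a) a.
Proof.
by rewrite (inverse_semigroup_assoc hS) (inverse_semigroup_invMK hS).
Qed.

(** If [x] is the inverse of [ef], then so is [fxe]. Uniqueness gives [x = fxe], which makes [x]
    idempotent, hence its own inverse and equal to [ef]. *)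
Lemma inverse_semigroup_idemM (S : Type) (op : S -> S -> S) (inv : S -> S)
    (hS : inverse_semigroup op inv) (e f : S) :
  op e e = e -> op f f = f -> op (op e f) (op e f) = op e f.
Proof.
move=> ee ff; have A := inverse_semigroup_assoc hS.
set x := inv (op e f).
have exf : op (op (op e f) x) (op e f) = op e f.
  exact: inverse_semigroup_mulVK hS _.
have xfx : op (op x (op e f)) x = x by exact: inverse_semigroup_invMK hS _.
rewrite !A in exf xfx.
have xE : x = op (op f x) e.
  apply: (inverse_semigroup_inv_eq hS); rewrite !A.
    by rewrite -(A e f f) ff -(A _ e e) ee.
  by rewrite -(A (op f x) e e) ee -(A _ f f) ff -!A (A x e) (A _ f) (A _ x) xfx.
have xx : op x x = x.
  by rewrite {1 2}xE !A -!A (A x e) (A _ f) (A _ x) xfx A -xE.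
have -> : op e f = x.
  rewrite -(inverse_semigroup_invK hS (op e f)) -/x.
  exact: (inverse_semigroup_inv_idem hS xx).
exact: xx.
Qed.

(** The idempotent [ef] is its own inverse, and [fe] is also an inverse of it. *)
Lemma inverse_semigroup_idemC (S : Type) (op : S -> S -> S) (inv : S -> S)
    (hS : inverse_semigroup op inv) (e f : S) :
  op e e = e -> op f f = f -> op e f = op f e.
Proof.
move=> ee ff; have A := inverse_semigroup_assoc hS.
have ef := inverse_semigroup_idemM hS ee ff.
have fe := inverse_semigroup_idemM hS ff ee.
rewrite -{1}(inverse_semigroup_inv_idem hS ef).
apply: (inverse_semigroup_inv_eq hS); rewrite !A.
  by rewrite -(A e f f) ff -(A _ e e) ee -A.
by rewrite -(A f e e) ee -(A _ f f) ff -A.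
Qed.

Lemma inverse_semigroup_invM (S : Type) (op : S -> S -> S) (inv : S -> S)
    (hS : inverse_semigroup op inv) (a b : S) :
  inv (op a b) = op (inv b) (inv a).
Proof.
have A := inverse_semigroup_assoc hS.
(* These are the idempotents that meet inside [a b b^-1 a^-1 a b]. *)
have C := inverse_semigroup_idemC hS (inverse_semigroup_mulV_idem hS b)
  (inverse_semigroup_Vmul_idem hS a).
have aK := inverse_semigroup_mulVK hS; have vK := inverse_semigroup_invMK hS.
apply: (inverse_semigroup_inv_eq hS).
  have -> : op (op (op a b) (op (inv b) (inv a))) (op a b)
          = op (op a (op (op b (inv b)) (op (inv a) a))) b by rewrite !A.
  by rewrite C !A aK -!A (A b) aK.
have -> : op (op (op (inv b) (inv a)) (op a b)) (op (inv b) (inv a))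
        = op (op (inv b) (op (op (inv a) a) (op b (inv b)))) (inv a).
  by rewrite !A.
by rewrite -C !A vK -!A (A (inv a)) vK.
Qed.

(** * Idempotents of a weak left brace, and its additive semigroup *)

Local Open Scope wlb_scope.

Lemma wlb_mul_idem_add (B : weakLeftBrace) (e : B) : e * e = e -> e + e = e.
Proof.
move=> ee; have M := wlb_mul_inverse_semigroup B.
have -> : e = - e + e.
  by rewrite -wlb_mul_inv (inverse_semigroup_inv_idem M ee) ee.
exact: inverse_semigroup_Vmul_idem (wlb_add_inverse_semigroup B) e.
Qed.

Lemma wlb_add_idem_mul (B : weakLeftBrace) (e : B) : e + e = e -> e * e = e.
Proof.
move=> ee; have P := wlb_add_inverse_semigroup B.
have -> : e = e * wlb_inv e.
  by rewrite wlb_mul_inv (inverse_semigroup_inv_idem P ee) ee.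
exact: inverse_semigroup_mulV_idem (wlb_mul_inverse_semigroup B) e.
Qed.

(** Distributivity expands the square of the idempotent [e + f]. Both [(e + f) * e] and
    [(e + f) * f] equal [e * f], which absorbs [e] and [f] additively, so the expansion collapses to
    [e * f]. *)
Lemma wlb_idem_mul_add (B : weakLeftBrace) (e f : B) :
  e + e = e -> f + f = f -> e * f = e + f.
Proof.
move=> ee ff.
have P := wlb_add_inverse_semigroup B; have M := wlb_mul_inverse_semigroup B.
have A := inverse_semigroup_assoc P; have AC := inverse_semigroup_idemC P.
have AM := inverse_semigroup_idemM P; have MM := inverse_semigroup_idemM M.
have absorb (a b : B) : a + a = a -> b + b = b -> a * b + a = a * b.
  move=> aa bb.
  have ab : a * b + a * b = a * b.
    by apply/wlb_mul_idem_add/MM; apply: wlb_add_idem_mul.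
  have := wlb_mul_add a b b.
  rewrite bb (inverse_semigroup_inv_idem P aa) => abE.
  by rewrite {2}abE -A (AC a (a * b) aa ab) A ab.
have ef : e * f + e * f = e * f.
  by apply/wlb_mul_idem_add/MM; apply: wlb_add_idem_mul.
have mulC (a b : B) : a + a = a -> b + b = b -> a * b = b * a.
  by move=> aa bb; apply: (inverse_semigroup_idemC M);
     apply: wlb_add_idem_mul.
have mulD (a b : B) : a + a = a -> b + b = b -> a * (a + b) = a * b.
  move=> aa bb; rewrite wlb_mul_add (inverse_semigroup_inv_idem P aa).
  rewrite (wlb_add_idem_mul aa) aa AC ?absorb //.
  by apply/wlb_mul_idem_add/MM; apply: wlb_add_idem_mul.
have hh := AM _ _ ee ff.
have he : (e + f) * e = e * f by rewrite mulC // mulD.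
have hf : (e + f) * f = e * f.
  by rewrite mulC // AC // mulD // mulC.
have := wlb_mul_add (e + f) e f.
rewrite (wlb_add_idem_mul hh) he hf (inverse_semigroup_inv_idem P hh).
by rewrite !A absorb // {1}mulC // absorb // mulC // ef => <-.
Qed.

(** The left side is [(e * y) * (e * y)^-1 = e * (y * y^-1) * e], a product of commuting
    idempotents. *)
Lemma wlb_mul_inv_idem_mul (B : weakLeftBrace) (e y : B) : e + e = e ->
  - (e * y) + e * y = e + (- y + y).
Proof.
move=> ee; have M := wlb_mul_inverse_semigroup B.
have A := inverse_semigroup_assoc M.
have P := wlb_add_inverse_semigroup B.
have yy := inverse_semigroup_Vmul_idem P y.
have eM := wlb_add_idem_mul ee.
rewrite -wlb_mul_inv (inverse_semigroup_invM M).
rewrite (inverse_semigroup_inv_idem M eM) A -(A e) wlb_mul_inv.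
rewrite -A [_ * e](inverse_semigroup_idemC M) ?(wlb_add_idem_mul yy) //.
by rewrite A eM wlb_idem_mul_add.
Qed.

(** The idempotent [- (e * y) + e * y] is a right identity of [e * y] and lies below [e]. *)
Lemma wlb_idem_mul_addr (B : weakLeftBrace) (e y : B) : e + e = e ->
  e * y + e = e * y.
Proof.
move=> ee; have P := wlb_add_inverse_semigroup B.
have A := inverse_semigroup_assoc P.
have yy := inverse_semigroup_Vmul_idem P y.
rewrite -{1}(inverse_semigroup_mulVK P (e * y)) -!A (A (- (e * y))).
rewrite wlb_mul_inv_idem_mul // (inverse_semigroup_idemC P ee yy) -A ee.
rewrite (inverse_semigroup_idemC P yy ee) -(wlb_mul_inv_idem_mul y ee).
by rewrite A (inverse_semigroup_mulVK P).
Qed.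

(* Distributing [g * (x + - x)] with [g = x + - x] shows [g * x = x], so the
   idempotent [x * x^-1 = - x + x] lies below [g]; with the same for [- x] the
   addition is Clifford. *)
Lemma wlb_subrr_addNr_le (B : weakLeftBrace) (x : B) :
  (x + - x) + (- x + x) = - x + x.
Proof.
have P := wlb_add_inverse_semigroup B; have M := wlb_mul_inverse_semigroup B.
have A := inverse_semigroup_assoc P.
set g := x + - x; set e := - x + x.
have gg : g + g = g by exact: inverse_semigroup_mulV_idem P x.
have ee : e + e = e by exact: inverse_semigroup_Vmul_idem P x.
have gN : g * - x = - x.
  have := inverse_semigroup_mulVK M (- x).
  by rewrite wlb_mul_inv (inverse_semigroup_invK P).
have gx : g * x + - x = g.
  have := wlb_mul_add g x (- x).
  rewrite -/g (wlb_add_idem_mul gg) (inverse_semigroup_inv_idem P gg) gN.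
  by rewrite wlb_idem_mul_addr // => <-.
have gxe : g * x + e = x.
  by rewrite A gx (inverse_semigroup_mulVK P).
(* Since [- (g * x) + g * x = g + e] absorbs [e], the sum [g * x + e] is also [g * x]. *)
have xE : g * x = x.
  rewrite -[RHS]gxe -{2}(inverse_semigroup_mulVK P (g * x)) -(A (g * x)).
  rewrite wlb_mul_inv_idem_mul // -/e -(A (g * x)) -(A g) ee.
  by rewrite -(wlb_mul_inv_idem_mul x gg) A (inverse_semigroup_mulVK P).
by rewrite -(wlb_mul_inv_idem_mul x gg) xE.
Qed.

Lemma wlb_add_clifford (B : weakLeftBrace) :
  clifford_semigroup (@wlb_add B) (@wlb_opp B).
Proof.
have P := wlb_add_inverse_semigroup B; split=> // x.
rewrite -wlb_subrr_addNr_le (inverse_semigroup_idemC P).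
- by have := wlb_subrr_addNr_le (- x); rewrite (inverse_semigroup_invK P).
- exact: inverse_semigroup_mulV_idem P x.
exact: inverse_semigroup_Vmul_idem P x.
Qed.

(** Both sides equal [e * (e + y)]. For [e * y], Clifford addition makes [e + (- y + y)] a left
    identity of it, so it absorbs [e] on the left. For [e + y], multiplication by [e] fixes the
    idempotent [(e + y) * (e + y)^-1]. *)
Lemma wlb_idem_mul (B : weakLeftBrace) (e y : B) : e + e = e -> e * y = e + y.
Proof.
move=> ee.
have P := wlb_add_inverse_semigroup B; have M := wlb_mul_inverse_semigroup B.
have A := inverse_semigroup_assoc P; have AM := inverse_semigroup_assoc M.
have C := clifford_semigroup_comm (wlb_add_clifford B).
have yy := inverse_semigroup_mulV_idem P y.
have eN := inverse_semigroup_inv_idem P ee.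
have eM := wlb_add_idem_mul ee.
have eeyE : e * (e + y) = e * y.
  rewrite wlb_mul_add eN eM ee -{1}(inverse_semigroup_mulVK P (e * y)).
  rewrite -C wlb_mul_inv_idem_mul // !A ee -[e + _ + _]A.
  rewrite -(wlb_mul_inv_idem_mul y ee) C.
  exact: inverse_semigroup_mulVK P _.
have uuE : e * ((e + y) * wlb_inv (e + y)) = (e + y) * wlb_inv (e + y).
  have uu := inverse_semigroup_mulV_idem P (e + y).
  by rewrite wlb_mul_inv C wlb_idem_mul_add // A (A e e) ee.
rewrite -eeyE -{1}(inverse_semigroup_mulVK M (e + y)) AM uuE.
exact: inverse_semigroup_mulVK M _.
Qed.

(** * The maps [wlb_lambda] and the comparison of [x^-1 * x] with [x * x^-1] *)

Lemma wlb_lambdaE (B : weakLeftBrace) (x y : B) :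
  wlb_lambda x y = x * (wlb_inv x + y).
Proof.
by rewrite wlb_mul_add wlb_mul_inv
  (inverse_semigroup_invMK (wlb_add_inverse_semigroup B)).
Qed.

Lemma wlb_lambda_idem (B : weakLeftBrace) (e y : B) : e + e = e ->
  wlb_lambda e y = e + y.
Proof.
move=> ee; have P := wlb_add_inverse_semigroup B.
rewrite /wlb_lambda (inverse_semigroup_inv_idem P ee) wlb_idem_mul //.
by rewrite (inverse_semigroup_assoc P) ee.
Qed.

Lemma lambda_anti_homomorphic_mulV_le (B : weakLeftBrace)
    (hB : lambda_anti_homomorphic B) (x : B) :
  (wlb_inv x * x) * (x * wlb_inv x) = wlb_inv x * x.
Proof.
have P := wlb_add_inverse_semigroup B; have M := wlb_mul_inverse_semigroup B.
have A := inverse_semigroup_assoc P; have AM := inverse_semigroup_assoc M.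
have C := clifford_semigroup_comm (wlb_add_clifford B).
have ff := wlb_mul_idem_add (inverse_semigroup_Vmul_idem M x).
have ee := wlb_mul_idem_add (inverse_semigroup_mulV_idem M x).
rewrite wlb_idem_mul //.
have fE : wlb_inv x * x = - wlb_inv x + wlb_inv x.
  by rewrite -wlb_mul_inv (inverse_semigroup_invK M).
set f := wlb_inv x * x in ff fE *; set e := x * wlb_inv x in ee *.
have ex : e + x = x.
  by rewrite /e wlb_mul_inv C (inverse_semigroup_mulVK P).
have fx : f + wlb_inv x = wlb_inv x.
  by rewrite fE C (inverse_semigroup_mulVK P).
have lambdaE z : wlb_lambda x (e + z) = wlb_lambda x z.
  by rewrite -wlb_lambda_idem // hB ex.
have cancel : wlb_inv x + (e + f) = wlb_inv x + f.
  have := congr1 (wlb_mul (wlb_inv x)) (lambdaE f).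
  (* The product [x^-1 * x] formed on the left is [f]; it acts as translation by [f], which [x^-1]
     absorbs. *)
  by rewrite !wlb_lambdaE !AM -/f !wlb_idem_mul // !(A f) fx.
have := congr1 (wlb_add (- wlb_inv x)) cancel.
by rewrite !A -fE ff -(A f) (inverse_semigroup_idemC P ee ff) A ff.
Qed.

Theorem proposition4p7 (B : weakLeftBrace) (hB : lambda_anti_homomorphic B) :
  dual_weak_left_brace B.
Proof.
have M := wlb_mul_inverse_semigroup B; split=> // x.
have fe := lambda_anti_homomorphic_mulV_le hB x.
have ef := lambda_anti_homomorphic_mulV_le hB (wlb_inv x).
rewrite (inverse_semigroup_invK M) in ef.
(* The two absorptions reduce the claim to commutation of the idempotents [x^-1 * x] and
   [x * x^-1]. *)
rewrite -[LHS]fe -[RHS]ef; apply: (inverse_semigroup_idemC M).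
  exact: inverse_semigroup_Vmul_idem M x.
exact: inverse_semigroup_mulV_idem M x.
Qed.
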